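(* For every index $\boldsymbol{k}$ and every $\bullet\in\{\emptyset,\star\}$, \[\overline{\zeta}^\bullet_{\widehat{\mathcal{Q}}}(\boldsymbol{k})=(-q^{-\boldsymbol{p}})^{\mathrm{wt}(\boldsymbol{k})}(q^{\boldsymbol{p}})^{\mathrm{dep}(\boldsymbol{k})}\sum_{\boldsymbol{l}\in\mathbb{Z}_{\ge0}^{\mathrm{dep}(\boldsymbol{k})}}(q^{-\boldsymbol{p}}[\boldsymbol{p}])^{\mathrm{wt}(\boldsymbol{l})}\,b\binom{\boldsymbol{k}}{\boldsymbol{l}}\,\zeta^\bullet_{\widehat{\mathcal{Q}}}(\overline{\boldsymbol{k}+\boldsymbol{l}})\] in $\widehat{\mathcal{Q}}$.
   Context: Indices. An index is $\boldsymbol{k}=(k_1,\dots,k_d)$ with $k_i$ positive integers (possibly empty; functions of indices equal $1$ on it). $\mathrm{wt}(\boldsymbol{k})=\sum k_i$ and $\mathrm{dep}(\boldsymbol{k})=d$. For $\boldsymbol{l}=(l_1,\dots,l_d)\in\mathbb{Z}_{\ge0}^d$: $\boldsymbol{k}+\boldsymbol{l}$ is the componentwise sum, $\mathrm{wt}(\boldsymbol{l})=\sum l_i$, $b\binom{\boldsymbol{k}}{\boldsymbol{l}}=\prod_{j=1}^d\binom{k_j+l_j-1}{l_j}$, and $\overline{(k_1,\dots,k_d)}=(k_d,\dots,k_1)$. $q$-sums. Let $[n]=(1-q^n)/(1-q)$, \[H_m(\boldsymbol{k};q)=\sum_{m\ge m_1>\cdots>m_d>0}\prod_a\frac{q^{(k_a-1)m_a}}{[m_a]^{k_a}},\qquad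 \overline{H}_m(\boldsymbol{k};q)=\sum_{m\ge m_1>\cdots>m_d>0}\prod_a\frac{q^{m_a}}{[m_a]^{k_a}},\] with star versions summed over $m\ge m_1\ge\cdots\ge m_d>0$. The ring $\widehat{\mathcal{Q}}$. For a prime $p$, $\mathbb{Z}_{(p)}$ is the set of rationals whose denominator is prime to $p$, and $Z_{p,n}=\mathbb{Z}_{(p)}[q]/([p]^n)$. Set $\mathcal{Q}_n=(\prod_pZ_{p,n})/(\bigoplus_pZ_{p,n})$ and $\widehat{\mathcal{Q}}=\varprojlim_n\mathcal{Q}_n$; here $[m]$ is invertible in $Z_{p,n}$ for $1\le m<p$. Define \[\zeta^\bullet_{\widehat{\mathcal{Q}}}(\boldsymbol{k})=((H^\bullet_{p-1}(\boldsymbol{k};q)\bmod[p]^n)_p)_n,\qquad \overline{\zeta}^\bullet_{\widehat{\mathcal{Q}}}(\boldsymbol{k})=((\overline{H}^\bullet_{p-1}(\boldsymbol{k};q)\bmod[p]^n)_p)_n.\] Put $[\boldsymbol{p}]=(([p]\bmod[p]^n)_p)_n$ and $q^{\boldsymbol{p}}=((q^p\bmod[p]^n)_p)_n=1-(1-q)[\boldsymbol{p}]$. Its inverse is $q^{-\boldsymbol{p}}=(((q^p)^{-1}\bmod[p]^n)_p)_n=\sum_{l\ge0}((1-q)[\boldsymbol{p}])^l$. The ring $\widehat{\mathcal{Q}}$ is complete in the $[\boldsymbol{p}]$-adic topology. *)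

(* Defs.v *)
From HB Require Import structures.
From mathcomp Require Import all_boot all_order all_algebra.
From mathcomp Require Import finmap all_classical.
From mathcomp Require Import topology summability.

Set Implicit Arguments.
Unset Strict Implicit.
Unset Printing Implicit Defensive.

Import Order.TTheory GRing.Theory Num.Theory.
Local Open Scope quotient_scope.
Local Open Scope ring_scope.

Definition prodring (I : Type) (R : I -> Type) := forall i, R i.

Section ProdRing.
Variables (I : pointedType) (R : I -> comNzRingType).
Local Notation P := (prodring R).

HB.instance Definition _ := Choice.copy P (forall i, R i).

Definition prodring_zero : P := fun i => 0.
Definition prodring_opp (f : P) : P := fun i => - f i.
Definition prodring_add (f g : P) : P := fun i => f i + g i.
Definition prodring_one : P := fun i => 1.
Definition prodring_mul (f g : P) : P := fun i => f i * g i.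

Let addA : associative prodring_add.
Proof. by move=> f g h; apply: functional_extensionality_dep => i; exact: addrA. Qed.
Let addC : commutative prodring_add.
Proof. by move=> f g; apply: functional_extensionality_dep => i; exact: addrC. Qed.
Let add0 : left_id prodring_zero prodring_add.
Proof. by move=> f; apply: functional_extensionality_dep => i; exact: add0r. Qed.
Let addN : left_inverse prodring_zero prodring_opp prodring_add.
Proof. by move=> f; apply: functional_extensionality_dep => i; exact: addNr. Qed.

HB.instance Definition _ := GRing.isZmodule.Build P addA addC add0 addN.

Let mulA : associative prodring_mul.
Proof. by move=> f g h; apply: functional_extensionality_dep => i; exact: mulrA. Qed.
Let mulC : commutative prodring_mul.
Proof. by move=> f g; apply: functional_extensionality_dep => i; exact: mulrC. Qed.
Let mul1 : left_id prodring_one prodring_mul.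
Proof. by move=> f; apply: functional_extensionality_dep => i; exact: mul1r. Qed.
Let mulD : left_distributive prodring_mul prodring_add.
Proof. by move=> f g h; apply: functional_extensionality_dep => i; exact: mulrDl. Qed.
Let one_neq0 : prodring_one != 0.
Proof.
apply/eqP => /(congr1 (fun f : P => f point)) /eqP.
by rewrite (negPf (oner_neq0 _)).
Qed.

HB.instance Definition _ :=
  GRing.Zmodule_isComNzRing.Build P mulA mulC mul1 mulD one_neq0.

End ProdRing.

Section Zloc.
Variable p : nat.

Definition Zloc_pred : {pred rat} := fun x => coprime p `|denq x|%N.

Lemma Zloc_predP (x : rat) :
  reflect (exists2 d : int, coprime p `|d|%N & exists n : int, x * d%:~R = n%:~R)
          (x \in Zloc_pred).
Proof.
apply: (iffP idP) => [xp | [d dp [n xd]]].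
  by exists (denq x) => //; exists (numq x); rewrite numqE.
rewrite unfold_in /Zloc_pred; apply: coprime_dvdr dp.
suff : (denq x %| d)%Z by [].
have : (denq x %| numq x * d)%Z.
  have : (numq x * d)%:~R = (n * denq x)%:~R :> rat.
    by rewrite !rmorphM /= -xd numqE mulrAC.
  by move=> /intr_inj ->; rewrite dvdz_mull.
by rewrite Gauss_dvdzr // coprimezE coprime_sym; exact: coprime_num_den.
Qed.

Let Zloc_closed : subring_closed Zloc_pred.
Proof.
split.
- by rewrite unfold_in /Zloc_pred coprimen1.
- move=> x y /Zloc_predP[d dp [m xd]] /Zloc_predP[e ep [n ye]].
  apply/Zloc_predP; exists (d * e); first by rewrite abszM coprimeMr dp.
  exists (m * e - n * d); rewrite rmorphB !rmorphM /= -xd -ye.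
  by rewrite mulrBl mulrA; congr (_ - _); rewrite -!mulrA; congr (_ * _); rewrite mulrC.
- move=> x y /Zloc_predP[d dp [m xd]] /Zloc_predP[e ep [n ye]].
  apply/Zloc_predP; exists (d * e); first by rewrite abszM coprimeMr dp.
  by exists (m * n); rewrite !rmorphM /= -xd -ye mulrACA.
Qed.

HB.instance Definition _ := GRing.isSubringClosed.Build rat Zloc_pred Zloc_closed.

Record Zloc := MkZloc { Zloc_val : rat; Zloc_valP : Zloc_val \in Zloc_pred }.

HB.instance Definition _ := [isSub for Zloc_val].
HB.instance Definition _ := [Choice of Zloc by <:].
HB.instance Definition _ := [SubChoice_isSubComNzRing of Zloc by <:].

End Zloc.

(* [m] = (1 - q^m) / (1 - q), as a polynomial in q; see [qnumE] *)
Definition qnum (R : pzSemiRingType) (q : R) (m : nat) : R := \sum_(i < m) q ^+ i.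

Lemma qnumE (R : pzRingType) (q : R) m : (1 - q) * qnum q m = 1 - q ^+ m.
Proof.
rewrite /qnum; elim: m => [|m IH]; first by rewrite big_ord0 mulr0 expr0 subrr.
by rewrite big_ord_recr /= mulrDr IH mulrBl mul1r -exprS addrA subrK.
Qed.

Lemma qnumS (R : pzSemiRingType) (q : R) m : qnum q m.+1 = 1 + q * qnum q m.
Proof.
rewrite /qnum big_ord_recl expr0 mulr_sumr; congr (_ + _).
by apply: eq_bigr => i _; rewrite -exprS.
Qed.

Lemma qnumD (R : pzSemiRingType) (q : R) m n :
  qnum q (m + n) = qnum q m + q ^+ m * qnum q n.
Proof.
elim: m => [|m IH]; first by rewrite /qnum big_ord0 add0r add0n mul1r.
by rewrite addSn !qnumS IH mulrDr addrA mulrA -exprS.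
Qed.

Lemma qnumM (R : comPzSemiRingType) (q : R) m n :
  qnum q (m * n) = qnum q m * qnum (q ^+ m) n.
Proof.
elim: n => [|n IH]; first by rewrite muln0 /qnum !big_ord0 mulr0.
by rewrite mulnS qnumD IH qnumS mulrDr mulr1 mulrCA.
Qed.

Lemma rmorph_qnum (R S : pzSemiRingType) (f : {rmorphism R -> S}) (q : R) m :
  f (qnum q m) = qnum (f q) m.
Proof. by rewrite /qnum rmorph_sum; apply: eq_bigr => i _; rewrite rmorphXn. Qed.

Lemma nilpotent_inv (R : comPzRingType) (x : R) n :
  x ^+ n = 0 -> exists y, y * (1 + x) = 1.
Proof.
move=> xn0; exists (qnum (- x) n).
by rewrite mulrC -{1}[x]opprK qnumE exprNn xn0 mulr0 subr0.
Qed.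

Lemma qnum_inv (R : comPzRingType) (q : R) (p m n : nat) :
  (0 < m)%N -> coprime m p -> qnum q p ^+ n = 0 -> exists y, y * qnum q m = 1.
Proof.
move=> m0 /eqP cmp nil; case: (egcdnP p m0) => a b eab _.
rewrite cmp in eab.
have [|y yE] := @nilpotent_inv _ (q * qnum q (b * p)) n.
  by rewrite mulnC qnumM !exprMn nil mul0r mulr0.
exists (y * qnum (q ^+ m) a).
by rewrite -mulrA [X in y * X]mulrC -qnumM mulnC eab addn1 qnumS.
Qed.

Section QSums.
Variables (R : comUnitRingType) (q : R).

(* Throughout, [star = false] is the plain version (m_1 > ... > m_d) and
   [star = true] the star version (m_1 >= ... >= m_d); [t] ranges over the
   tuples (m_1, ..., m_d) with entries at most [m]. The empty index gives 1. *)
Definition qrange (star : bool) (m d : nat) (t : d.-tuple 'I_m.+1) : bool :=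
  all (fun i : 'I_m.+1 => 0 < i)%N t
  && sorted (if star then geq else gtn) [seq val i | i <- t].

Definition qH (star : bool) (m d : nat) (k : d.-tuple nat) : R :=
  \sum_(t : d.-tuple 'I_m.+1 | qrange star t)
    \prod_(a < d) (q ^+ ((tnth k a).-1 * tnth t a)
                    / qnum q (tnth t a) ^+ tnth k a).

Definition qHbar (star : bool) (m d : nat) (k : d.-tuple nat) : R :=
  \sum_(t : d.-tuple 'I_m.+1 | qrange star t)
    \prod_(a < d) (q ^+ tnth t a / qnum q (tnth t a) ^+ tnth k a).

End QSums.

Section QSumsMorph.
Variables (R S : comUnitRingType) (f : {rmorphism R -> S}) (q : R) (m : nat).
Hypothesis qU : forall i, (0 < i <= m)%N -> qnum q i \is a GRing.unit.

Let morph_term star d (t : d.-tuple 'I_m.+1) (e : nat -> nat -> nat)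
    (k : d.-tuple nat) : qrange star t ->
  f (\prod_(a < d) (q ^+ e (tnth k a) (tnth t a) / qnum q (tnth t a) ^+ tnth k a))
  = \prod_(a < d) (f q ^+ e (tnth k a) (tnth t a)
                    / qnum (f q) (tnth t a) ^+ tnth k a).
Proof.
move=> /andP[/all_tnthP t0 _]; rewrite rmorph_prod; apply: eq_bigr => a _.
have U : qnum q (tnth t a) \is a GRing.unit by rewrite qU // t0 -ltnS ltn_ord.
by rewrite rmorphM rmorphXn rmorphV ?unitrX // rmorphXn rmorph_qnum.
Qed.

Lemma rmorph_qH star d (k : d.-tuple nat) : f (qH q star m k) = qH (f q) star m k.
Proof.
rewrite /qH rmorph_sum; apply: eq_bigr => t tr.
exact: (morph_term (fun k m => k.-1 * m)%N k tr).
Qed.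

Lemma rmorph_qHbar star d (k : d.-tuple nat) :
  f (qHbar q star m k) = qHbar (f q) star m k.
Proof.
rewrite /qHbar rmorph_sum; apply: eq_bigr => t tr.
exact: (morph_term (fun _ m => m) k tr).
Qed.

End QSumsMorph.

Record primenat := MkPrimenat { primenat_val :> nat; primenatP : prime primenat_val }.

HB.instance Definition _ := [isSub for primenat_val].
HB.instance Definition _ := [Countable of primenat by <:].
HB.instance Definition _ :=
  isPointed.Build primenat (@MkPrimenat 2 (isT : prime 2)).

(* [Zquo p n] is Z_(p)[q] / ([p]^(n+1)), and likewise [Qring n] below is the ring
   of level n+1: level 0 is the zero ring and is irrelevant to the inverse limit.
   The inverse is chosen classically, so that every invertible element,
   such as [m] for 0 < m < p ([qnumZ_unit]), is a unit. *)

Section Zquo.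
Variables (p : primenat) (n : nat).

Definition pow_ideal : {pred {poly Zloc p}} :=
  fun f => `[< exists g, f = g * qnum 'X p ^+ n.+1 >].

Let pow_ideal_closed : idealr_closed pow_ideal.
Proof.
split.
- by apply/asboolP; exists 0; rewrite mul0r.
- apply/asboolP => -[g].
  have qE : qnum 'X p = \poly_(i < p) 1 :> {poly Zloc p}.
    by rewrite /qnum poly_def; apply: eq_bigr => i _; rewrite scale1r.
  have p0 : (0 < p)%N by rewrite prime_gt0 ?primenatP.
  have sq : size (qnum 'X p : {poly Zloc p}) = p.
    by rewrite qE size_poly_eq // oner_neq0.
  have mq : qnum 'X p \is @monic (Zloc p).
    by apply/monicP; rewrite qE lead_coef_poly // oner_neq0.
  rewrite exprSr mulrA; set h := g * _ => hE.
  have [h0|h0] := eqVneq h 0.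
    by move/eqP: hE; rewrite h0 mul0r oner_eq0.
  have := congr1 (fun f : {poly _} => size f) hE.
  rewrite /= size_Mmonic // size_poly1 sq => sE.
  have := prime_gt1 (primenatP p); have : (0 < size h)%N by rewrite size_poly_gt0.
  by case: (size h) sE => // a; rewrite addSn /= => sE _ p1; move: (leq_addl a p); rewrite -sE leqNgt p1.
- move=> a _ _ /asboolP[g ->] /asboolP[h ->]; apply/asboolP.
  by exists (a * g + h); rewrite mulrDl mulrA.
Qed.

HB.instance Definition _ := isIdealr.Build {poly Zloc p} pow_ideal pow_ideal_closed.

Definition Zquo := {ideal_quot pow_ideal}.
HB.instance Definition _ := GRing.ComNzRing.on Zquo.

Definition Zquo_unit : {pred Zquo} := fun x => `[< exists y, y * x = 1 >].
Definition Zquo_inv (x : Zquo) : Zquo :=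
  if pselect (exists y, y * x = 1) is left ex then sval (cid ex) else x.

Let mulVx : {in Zquo_unit, left_inverse 1 Zquo_inv *%R}.
Proof.
move=> x /asboolP ex; rewrite /Zquo_inv; case: pselect => // ex'.
exact: (svalP (cid ex')).
Qed.
Let unitPl (x y : Zquo) : y * x = 1 -> x \in Zquo_unit.
Proof. by move=> yx; apply/asboolP; exists y. Qed.
Let inv_out : {in [predC Zquo_unit], Zquo_inv =1 id}.
Proof.
move=> x /asboolPn nx; rewrite /Zquo_inv; by case: pselect.
Qed.

HB.instance Definition _ :=
  GRing.ComNzRing_hasMulInverse.Build Zquo mulVx unitPl inv_out.

Definition Zquo_pi (f : {poly Zloc p}) : Zquo := \pi_({ideal_quot pow_ideal}) f.
HB.instance Definition _ := GRing.RMorphism.copy Zquo_pi \pi_({ideal_quot pow_ideal}).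

Definition qZ : Zquo := Zquo_pi 'X.

Lemma Zquo_piP (f g : {poly Zloc p}) :
  Zquo_pi f = Zquo_pi g <-> exists h, f - g = h * qnum 'X p ^+ n.+1.
Proof.
split=> [/eqP|fg].
  by rewrite eqmodE => /asboolP.
by apply/eqP; rewrite eqmodE; apply/asboolP.
Qed.

Lemma qnumZ_nilp : qnum qZ p ^+ n.+1 = 0.
Proof.
rewrite /qZ -rmorph_qnum -rmorphXn -[RHS](rmorph0 Zquo_pi).
by apply/Zquo_piP; exists 1; rewrite subr0 mul1r.
Qed.

Lemma unitZP (x : Zquo) : (exists y, y * x = 1) -> x \is a GRing.unit.
Proof. by move=> ex; apply/asboolP. Qed.

Lemma qnumZ_unit (m : nat) : (0 < m <= p.-1)%N -> qnum qZ m \is a GRing.unit.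
Proof.
have p0 : (0 < p)%N by rewrite prime_gt0 ?primenatP.
move=> /andP[m0 mp]; apply/unitZP/(qnum_inv m0 _ qnumZ_nilp).
rewrite coprime_sym prime_coprime ?primenatP //; apply/negP => /dvdn_leq.
by move=> /(_ m0); rewrite leqNgt -(prednK p0) ltnS mp.
Qed.

Lemma qpZ_unit : qZ ^+ p \is a GRing.unit.
Proof.
apply/unitZP; have -> : qZ ^+ p = 1 + (qZ - 1) * qnum qZ p.
  by rewrite -opprB mulNr qnumE opprB addrCA subrr addr0.
by apply: (@nilpotent_inv _ _ n.+1); rewrite exprMn qnumZ_nilp mulr0.
Qed.

End Zquo.

Section Zquo_red.
Variables (p : primenat) (n : nat).

(* defined on representatives; the map induced on quotients, by [Zquo_redE] *)
Definition Zquo_red (x : Zquo p n.+1) : Zquo p n := Zquo_pi n (repr x).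

Lemma Zquo_redE f : Zquo_red (Zquo_pi n.+1 f) = Zquo_pi n f.
Proof.
apply/Zquo_piP; have /Zquo_piP[h hE] : Zquo_pi n.+1 (repr (Zquo_pi n.+1 f)) = Zquo_pi n.+1 f.
  exact: reprK.
by exists (h * qnum 'X p); rewrite hE [in LHS]exprS mulrA.
Qed.

Lemma Zquo_piW (x : Zquo p n.+1) : exists f, x = Zquo_pi n.+1 f.
Proof. by exists (repr x); rewrite /Zquo_pi reprK. Qed.

Let red_zmod : zmod_morphism Zquo_red.
Proof.
move=> x y; have [f ->] := Zquo_piW x; have [g ->] := Zquo_piW y.
by rewrite -rmorphB !Zquo_redE rmorphB.
Qed.

Let red_monoid : monoid_morphism Zquo_red.
Proof.
split=> [|x y]; first by rewrite -(rmorph1 (@Zquo_pi p n.+1)) Zquo_redE rmorph1.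
have [f ->] := Zquo_piW x; have [g ->] := Zquo_piW y.
by rewrite -rmorphM !Zquo_redE rmorphM.
Qed.

HB.instance Definition _ := GRing.isZmodMorphism.Build _ _ Zquo_red red_zmod.
HB.instance Definition _ := GRing.isMonoidMorphism.Build _ _ Zquo_red red_monoid.

Lemma Zquo_red_q : Zquo_red (qZ p n.+1) = qZ p n.
Proof. exact: Zquo_redE. Qed.

End Zquo_red.

Section Qring.
Variable n : nat.

Definition dirsum : {pred prodring (fun p => Zquo p n)} :=
  fun f => `[< finite_set [set p | f p != 0] >].

Let dirsum_closed : idealr_closed dirsum.
Proof.
split.
- apply/asboolP; rewrite (_ : [set p | _] = set0)%classic ?finite_set0 //.
  by apply/seteqP; split=> p //=; rewrite eqxx.
- apply/asboolP => /finite_seqP[s sE].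
  have [p] := prime_above (\max_(i <- s) val i).
  move=> /[swap] pp; apply/negP; rewrite -leqNgt.
  have ps : MkPrimenat pp \in s.
    have : [set` s]%classic (MkPrimenat pp) by rewrite -sE /=; exact: oner_neq0.
    by [].
  by rewrite (leq_bigmax_seq (F := val) _ ps).
- move=> a f g /asboolP fF /asboolP gF; apply/asboolP.
  apply: (@sub_finite_set _ _ ([set p | f p != 0] `|` [set p | g p != 0])%classic);
    last by rewrite finite_setU.
  move=> p /= nz; apply/orP; apply: contraNT nz.
  rewrite negb_or !negbK => /andP[/eqP f0 /eqP g0].
  have -> : (a * f + g) p = a p * f p + g p by [].
  by rewrite f0 g0 mulr0 addr0.
Qed.

HB.instance Definition _ :=
  isIdealr.Build (prodring (fun p => Zquo p n)) dirsum dirsum_closed.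

Definition Qring := {ideal_quot dirsum}.
HB.instance Definition _ := GRing.ComNzRing.on Qring.

Definition Qring_pi (f : prodring (fun p => Zquo p n)) : Qring :=
  \pi_({ideal_quot dirsum}) f.
HB.instance Definition _ := GRing.RMorphism.copy Qring_pi \pi_({ideal_quot dirsum}).

Lemma Qring_piM (f g : prodring (fun p => Zquo p n)) :
  Qring_pi f * Qring_pi g = Qring_pi (fun p => f p * g p).
Proof. by rewrite -rmorphM. Qed.

Lemma Qring_piP (f g : prodring (fun p => Zquo p n)) :
  Qring_pi f = Qring_pi g <-> finite_set [set p | f p != g p].
Proof.
have -> : [set p | f p != g p]%classic = [set p | (f - g) p != 0]%classic.
  by apply/seteqP; split=> p /=; rewrite [(f - g) p]/(f p - g p) subr_eq0.
split=> [/eqP|fg].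
  by rewrite eqmodE => /asboolP.
by apply/eqP; rewrite eqmodE; apply/asboolP.
Qed.

End Qring.

Section Qring_red.
Variable n : nat.

(* likewise, by [Qring_redE] *)
Definition Qring_red (x : Qring n.+1) : Qring n :=
  Qring_pi (fun p => Zquo_red (repr x p)).

Lemma Qring_redE f : Qring_red (Qring_pi f) = Qring_pi (fun p => Zquo_red (f p)).
Proof.
apply/Qring_piP; have /Qring_piP : Qring_pi (repr (Qring_pi f)) = Qring_pi f.
  exact: reprK.
apply: sub_finite_set => p /=; apply: contraNN => /eqP -> //.
Qed.

Lemma Qring_piW (x : Qring n.+1) : exists f, x = Qring_pi f.
Proof. by exists (repr x); rewrite /Qring_pi reprK. Qed.

Let red_zmod : zmod_morphism Qring_red.
Proof.
move=> x y; have [f ->] := Qring_piW x; have [g ->] := Qring_piW y.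
rewrite -rmorphB !Qring_redE -rmorphB; congr Qring_pi.
by apply: functional_extensionality_dep => p; exact: rmorphB.
Qed.

Let red_monoid : monoid_morphism Qring_red.
Proof.
split=> [|x y].
  rewrite -(rmorph1 (@Qring_pi n.+1)) Qring_redE -[RHS](rmorph1 (@Qring_pi n)).
  by congr Qring_pi; apply: functional_extensionality_dep => p; exact: rmorph1.
have [f ->] := Qring_piW x; have [g ->] := Qring_piW y.
rewrite -rmorphM !Qring_redE -rmorphM; congr Qring_pi.
by apply: functional_extensionality_dep => p; exact: rmorphM.
Qed.

HB.instance Definition _ := GRing.isZmodMorphism.Build _ _ Qring_red red_zmod.
HB.instance Definition _ := GRing.isMonoidMorphism.Build _ _ Qring_red red_monoid.

End Qring_red.

Definition Qhat_pred : {pred prodring Qring} :=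
  fun x => `[< forall n, Qring_red (x n.+1) = x n >].

Lemma Qhat_closed : subring_closed Qhat_pred.
Proof.
split.
- by apply/asboolP => n; exact: rmorph1.
- move=> x y /asboolP xP /asboolP yP; apply/asboolP => n.
  by rewrite -[(x - y) n.+1]/(x n.+1 - y n.+1) rmorphB /= xP yP.
- move=> x y /asboolP xP /asboolP yP; apply/asboolP => n.
  by rewrite -[(x * y) n.+1]/(x n.+1 * y n.+1) rmorphM /= xP yP.
Qed.

HB.instance Definition _ := GRing.isSubringClosed.Build _ Qhat_pred Qhat_closed.

Record Qhat := MkQhat { Qhat_val : prodring Qring; Qhat_valP : Qhat_val \in Qhat_pred }.

HB.instance Definition _ := [isSub for Qhat_val].
HB.instance Definition _ := [Choice of Qhat by <:].
HB.instance Definition _ := [SubChoice_isSubComNzRing of Qhat by <:].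
HB.instance Definition _ := isPointed.Build Qhat 0.

Lemma Qhat_valM (x y : Qhat) n :
  Qhat_val (x * y) n = Qhat_val x n * Qhat_val y n.
Proof. by []. Qed.

(* the element [((x n p)_p)_n] of the inverse limit *)
Section Qhat_of.
Variable x : forall (n : nat) (p : primenat), Zquo p n.
Hypothesis xP : forall n p, Zquo_red (x n.+1 p) = x n p.

Fact Qhat_of_subproof : (fun n => Qring_pi (x n)) \in Qhat_pred.
Proof.
apply/asboolP => n; rewrite Qring_redE; congr Qring_pi.
by apply: functional_extensionality_dep => p; exact: xP.
Qed.

Definition Qhat_of : Qhat := MkQhat Qhat_of_subproof.

End Qhat_of.

Fact zetaQ_subproof star d (k : d.-tuple nat) n (p : primenat) :
  Zquo_red (qH (qZ p n.+1) star p.-1 k) = qH (qZ p n) star p.-1 k.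
Proof. by rewrite rmorph_qH /= ?Zquo_red_q //; exact: qnumZ_unit. Qed.

Definition zetaQ (star : bool) (d : nat) (k : d.-tuple nat) : Qhat :=
  Qhat_of (zetaQ_subproof star k).

Fact zetabarQ_subproof star d (k : d.-tuple nat) n (p : primenat) :
  Zquo_red (qHbar (qZ p n.+1) star p.-1 k) = qHbar (qZ p n) star p.-1 k.
Proof. by rewrite rmorph_qHbar /= ?Zquo_red_q //; exact: qnumZ_unit. Qed.

Definition zetabarQ (star : bool) (d : nat) (k : d.-tuple nat) : Qhat :=
  Qhat_of (zetabarQ_subproof star k).

Fact brp_subproof n (p : primenat) : Zquo_red (qnum (qZ p n.+1) p) = qnum (qZ p n) p.
Proof. by rewrite rmorph_qnum /= Zquo_red_q. Qed.

(* the element [p] given by the family of the q-integers [p] *)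
Definition brp : Qhat := Qhat_of brp_subproof.

Fact qp_subproof n (p : primenat) : Zquo_red (qZ p n.+1 ^+ p) = qZ p n ^+ p.
Proof. by rewrite rmorphXn /= Zquo_red_q. Qed.

Definition qp : Qhat := Qhat_of qp_subproof.

Fact qpinv_subproof n (p : primenat) :
  Zquo_red (qZ p n.+1 ^+ p)^-1 = (qZ p n ^+ p)^-1.
Proof. by rewrite rmorphV ?qpZ_unit // rmorphXn /= Zquo_red_q. Qed.

Definition qpinv : Qhat := Qhat_of qpinv_subproof.

Lemma qpinvK : qpinv * qp = 1.
Proof.
apply: val_inj; apply: functional_extensionality_dep => n.
rewrite [LHS](Qhat_valM qpinv qp n) [LHS]Qring_piM.
rewrite -[RHS](rmorph1 (@Qring_pi n)); congr Qring_pi.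
by apply: functional_extensionality_dep => p; rewrite [LHS]mulVr // qpZ_unit.
Qed.

Section Qhat_topology.
Local Open Scope classical_set_scope.

(* the coset x + [p]^n Qhat *)
Definition Qhat_ball (x : Qhat) (n : nat) : set Qhat :=
  [set y | exists z, y - x = brp ^+ n * z].

HB.instance Definition _ :=
  hasNbhs.Build Qhat (fun x => filter_from setT (Qhat_ball x)).

Let ballW x m n : (m <= n)%N -> Qhat_ball x n `<=` Qhat_ball x m.
Proof.
by move=> mn y [z yE]; exists (brp ^+ (n - m) * z); rewrite mulrA -exprD subnKC.
Qed.

Let nbhs_filter (x : Qhat) : ProperFilter (nbhs x).
Proof.
apply: filter_from_proper; last first.
  by move=> n _; exists x; exists 0; rewrite subrr mulr0.
apply: filter_fromT_filter; first by exists 0%N.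
move=> m n; exists (maxn m n) => y yB; split.
- exact: ballW (leq_maxl _ _) _ yB.
- exact: ballW (leq_maxr _ _) _ yB.
Qed.

Let nbhs_singleton (x : Qhat) (A : set Qhat) : nbhs x A -> A x.
Proof. by case=> n _; apply; exists 0; rewrite subrr mulr0. Qed.

Let nbhs_nbhs (x : Qhat) (A : set Qhat) : nbhs x A -> nbhs x (nbhs^~ A).
Proof.
case=> n _ nA; exists n => // y [z yE]; exists n => // t [u tE]; apply: nA.
by exists (u + z); rewrite -(subrK y t) -addrA yE tE mulrDr.
Qed.

HB.instance Definition _ :=
  Nbhs_isNbhsTopological.Build Qhat nbhs_filter nbhs_singleton nbhs_nbhs.

Lemma brp_exp_val (m n : nat) : (n < m)%N -> Qhat_val (brp ^+ m) n = 0.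
Proof.
move=> nm; have [r ->] : exists r, m = (r + n.+1)%N by exists (m - n.+1)%N; rewrite subnK.
suff E : Qhat_val (brp ^+ n.+1) n = 0.
  by rewrite exprD Qhat_valM E mulr0.
have expE k : Qhat_val (brp ^+ k) n = Qring_pi (fun p => qnum (qZ p n) p ^+ k).
  elim: k => [|k IH]; first by rewrite expr0 -[LHS](rmorph1 (@Qring_pi n)).
  rewrite exprS Qhat_valM IH [LHS]Qring_piM.
  by congr Qring_pi; apply: functional_extensionality_dep => p; rewrite exprS.
rewrite expE -[RHS](rmorph0 (@Qring_pi n)); congr Qring_pi.
by apply: functional_extensionality_dep => p; rewrite qnumZ_nilp.
Qed.

Lemma Qhat_hausdorff : hausdorff_space Qhat.
Proof.
move=> x y xy; apply: val_inj; apply: functional_extensionality_dep => n.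
have ballN t : nbhs t (Qhat_ball t n.+1) by exists n.+1.
have [z [[u zx] [v zy]]] := xy _ _ (ballN x) (ballN y).
have E : x - y = brp ^+ n.+1 * (v - u).
  by rewrite mulrBr -zx -zy opprB [RHS]addrC addrA subrK.
apply/eqP; rewrite -subr_eq0; apply/eqP.
rewrite -[LHS]/(Qhat_val (x - y) n) E Qhat_valM.
by rewrite brp_exp_val ?mul0r.
Qed.

End Qhat_topology.

Definition wt (d : nat) (k : d.-tuple nat) : nat := (\sum_(i < d) tnth k i)%N.

Definition index_add (d : nat) (k l : d.-tuple nat) : d.-tuple nat :=
  [tuple (tnth k i + tnth l i)%N | i < d].

(* the predecessor is not truncated on indices, whose entries [k_j] are positive *)
Definition index_bin (d : nat) (k l : d.-tuple nat) : nat :=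
  (\prod_(j < d) 'C((tnth k j + tnth l j).-1, tnth l j))%N.

(* Main.v *)
(** The substitution m_a |-> p - m_(d+1-a) reverses the index and preserves both
    summation ranges. Since [p] = [p - m] + q^(p-m) [m], it gives
    [p - m] = - q^(p-m) [m] (1 - x) with x = q^(-p) [p] q^m / [m], and x is
    nilpotent modulo [p]^n. Expanding (1 - x)^(-k) by the binomial series, which is
    finite modulo [p]^n, yields the identity at each level n. The series converges in
    the [p]-adic topology because an element of the inverse limit that vanishes at
    level n is a multiple of [p]^n, [p] being a monic polynomial in q. *)
Require Import Defs.
From HB Require Import structures.
From mathcomp Require Import all_boot all_order all_algebra.
From mathcomp Require Import finmap all_classical.
From mathcomp Require Import topology summability.
From mathcomp Require Import ring.

Import GRing.Theory.

Local Open Scope classical_set_scope.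
Local Open Scope ring_scope.

(** * Negative binomial series and the reflection of a single factor *)

(** Induction on the exponent: the geometric sum settles exponent 1, and multiplying the next series
    by [1 - x] gives back the previous one by Pascal's rule. *)
Lemma negative_binomial (R : comPzRingType) (x : R) (k N : nat) :
  (0 < k)%N -> x ^+ N = 0 ->
  (1 - x) ^+ k * \sum_(l < N) 'C((k + l).-1, l)%:R * x ^+ l = 1.
Proof.
case: k => // k _ xN0; elim: k => [|k IH].
  transitivity ((1 - x) * qnum x N); last by rewrite qnumE xN0 subr0.
  rewrite expr1; congr (_ * _).
  by apply: eq_bigr => l _; rewrite add1n binn mul1r.
rewrite exprSr -mulrA -[RHS]IH; congr (_ * _).
(* A general truncation [M] exposes the boundary term, which vanishes at [M = N] because
   [x ^+ N = 0]. *)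
have telescope M : (1 - x) * (\sum_(l < M) 'C((k.+2 + l).-1, l)%:R * x ^+ l)
    + 'C(k + M, k.+1)%:R * x ^+ M = \sum_(l < M) 'C((k.+1 + l).-1, l)%:R * x ^+ l.
  elim: M => [|M IHM]; first by rewrite !big_ord0 addn0 bin_small // mulr0 mul0r add0r.
  rewrite !big_ord_recr /= -IHM.
  have -> : 'C((k.+2 + M).-1, M) = ('C(k + M, k.+1) + 'C(k + M, k))%N.
    by rewrite -binS -[RHS]bin_sub ?ltnS ?leq_addr // subSS addKn.
  have -> : 'C((k.+1 + M).-1, M) = 'C(k + M, k).
    by rewrite -[RHS]bin_sub ?leq_addr // addKn.
  rewrite addnS binS natrD exprS; ring.
by have := telescope N; rewrite xN0 mulr0 addr0.
Qed.

Lemma unit_of_expr (R : comUnitRingType) (q : R) (p : nat) :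
  (0 < p)%N -> q ^+ p \is a GRing.unit -> q \is a GRing.unit.
Proof. by case: p => // p _; rewrite exprS unitrM => /andP[]. Qed.

(* The reflection [p - m] = - q^(p-m) [m] (1 - x), with x = q^m [p] / (q^p [m])
   nilpotent, turns the negative powers of [p - m] into binomial series in x. *)
Lemma reflected_factor (R : comUnitRingType) (q : R) (p m k N : nat) :
  (0 < m < p)%N -> (0 < k)%N -> q ^+ p \is a GRing.unit ->
  qnum q m \is a GRing.unit -> qnum q (p - m) \is a GRing.unit ->
  qnum q p ^+ N = 0 ->
  q ^+ (p - m) / qnum q (p - m) ^+ k =
  (- (q ^+ p)^-1) ^+ k * q ^+ p *
  \sum_(l < N) ((q ^+ p)^-1 * qnum q p) ^+ l * 'C((k + l).-1, l)%:R *
    (q ^+ ((k + l).-1 * m) / qnum q m ^+ (k + l)).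
Proof.
move=> /andP[m_gt0 mp] k_gt0 Qu mu pmu pN0.
have qu : q \is a GRing.unit by apply: unit_of_expr Qu; exact: leq_ltn_trans mp.
have Q_split : q ^+ p = q ^+ (p - m) * q ^+ m by rewrite -exprD subnK // ltnW.
have p_split : qnum q p = qnum q (p - m) + q ^+ (p - m) * qnum q m.
  by rewrite -qnumD subnK // ltnW.
set Q := q ^+ p in Qu Q_split *; set P := qnum q p in pN0 p_split *.
pose x := Q^-1 * P * (q ^+ m / qnum q m).
have xN0 : x ^+ N = 0 by rewrite !exprMn pN0 mulr0 mul0r.
have reflect : qnum q (p - m) * q ^+ m = - Q * qnum q m * (1 - x).
  have -> : - Q * qnum q m * (1 - x) =
      - Q * qnum q m + (Q * Q^-1) * P * q ^+ m * (qnum q m / qnum q m).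
    by rewrite /x; ring.
  by rewrite !divrr // p_split Q_split; ring.
(* Since [k > 0], the exponent of q splits as (k - 1)m + lm, which lets a factor independent of [l]
   come out of the sum. *)
have -> : \sum_(l < N) (Q^-1 * P) ^+ l * 'C((k + l).-1, l)%:R *
    (q ^+ ((k + l).-1 * m) / qnum q m ^+ (k + l)) =
    q ^+ (k.-1 * m) / qnum q m ^+ k * \sum_(l < N) 'C((k + l).-1, l)%:R * x ^+ l.
  rewrite [RHS]mulr_sumr; apply: eq_bigr => l _.
  have -> : (k + l).-1 = (k.-1 + l)%N by case: (k) k_gt0.
  rewrite mulnDl !exprD invrM ?unitrX // /x [in RHS]exprMn expr_div_n.
  rewrite -exprM [(m * l)%N]mulnC.
  set y := _ ^+ l; ring.
(* After multiplication by this unit, both sides become q^p q^((k-1)m). *)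
apply: (@mulIr _ ((qnum q (p - m) * q ^+ m) ^+ k)).
  by rewrite unitrX // unitrM pmu unitrX.
have NQ : (- Q^-1) ^+ k * (- Q) ^+ k = 1 by rewrite -exprMn mulrNN mulVr // expr1n.
rewrite [in RHS]reflect !exprMn.
set S := \sum_(_ < _) _.
transitivity (Q * q ^+ (k.-1 * m)); last first.
  transitivity (((- Q^-1) ^+ k * (- Q) ^+ k) * (Q * q ^+ (k.-1 * m))
     * (qnum q m ^+ k / qnum q m ^+ k) * ((1 - x) ^+ k * S)); last by ring.
  by rewrite NQ divrr ?unitrX // negative_binomial // !mulr1 mul1r.
transitivity (q ^+ (p - m) * q ^+ m ^+ k * (qnum q (p - m) ^+ k / qnum q (p - m) ^+ k)).
  by ring.
rewrite divrr ?unitrX // mulr1 Q_split -mulrA; congr (_ * _).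
by rewrite -exprM mulnC -exprD; case: (k) k_gt0.
Qed.

(** * Reflection of the summation range *)

Lemma tnth_rev_tuple {T : Type} {d : nat} (t : d.-tuple T) (i : 'I_d) :
  tnth [tuple of rev t] i = tnth t (rev_ord i).
Proof.
have x0 := tnth t i.
by rewrite !(tnth_nth x0) /= nth_rev size_tuple.
Qed.

(* The involution (m_1, ..., m_d) |-> (M + 1 - m_d, ..., M + 1 - m_1); negation in
   'I_M.+1 is subtraction from M + 1 on nonzero entries. *)
Definition reflect_tuple {M d : nat} (t : d.-tuple 'I_M.+1) : d.-tuple 'I_M.+1 :=
  [tuple of rev [tuple of map -%R t]].

Lemma tnth_reflect_tuple {M d : nat} (t : d.-tuple 'I_M.+1) (i : 'I_d) :
  tnth (reflect_tuple t) i = - tnth t (rev_ord i).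
Proof. by rewrite tnth_rev_tuple tnth_map. Qed.

Lemma reflect_tupleK {M d : nat} : involutive (@reflect_tuple M d).
Proof.
by move=> t; apply: eq_from_tnth => i; rewrite !tnth_reflect_tuple rev_ordK opprK.
Qed.

Lemma val_ordN {M : nat} (i : 'I_M.+1) : (0 < i)%N -> (- i)%R = (M.+1 - i)%N :> nat.
Proof. by move=> i_gt0; rewrite /= modn_small // ltn_subrL i_gt0. Qed.

(** Negation and list reversal each reverse the order of positive entries, so together they preserve
    it. Positivity matters: negation in ['I_M.+1] fixes 0. *)
Lemma qrange_reflect (star : bool) (M d : nat) (t : d.-tuple 'I_M.+1) :
  qrange star t -> qrange star (reflect_tuple t).
Proof.
move=> /andP[t_gt0 t_sorted]; apply/andP; split.
  rewrite all_rev all_map; apply: sub_all t_gt0 => i i_gt0.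
  by change (0 < nat_of_ord (- i))%N; rewrite val_ordN // subn_gt0.
rewrite [tval _]/= map_rev rev_sorted -map_comp.
rewrite (mono_sorted_in (e := relpre val (if star then geq else gtn)) _ t_gt0)
  -?sorted_map //.
move=> i j; rewrite !unfold_in => i_gt0 j_gt0.
have iM := ltn_ord i; have jM := ltn_ord j.
set e := if star then geq else gtn.
rewrite [LHS]/(e (nat_of_ord (- j)) (nat_of_ord (- i))) !val_ordN // /e.
by case: (star); rewrite /= ?leq_sub2lE ?ltn_sub2lE // ltnW.
Qed.

(** * Expansion of the sums in a ring where [p] is nilpotent *)

(** Expanding a product of [d] series truncated at [N] gives a sum over functions choosing one
    exponent per factor; these encode the box of exponent vectors. *)
Definition tuple_of_ffun {d N : nat} (f : {ffun 'I_d -> 'I_N}) : d.-tuple nat :=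
  [tuple nat_of_ord (f i) | i < d].

Lemma qHbar_expansion (R : comUnitRingType) (q : R) (star : bool) (p d N : nat)
    (k : d.-tuple nat) :
  (0 < p)%N -> (forall i, 0 < tnth k i)%N ->
  (forall m, (0 < m <= p.-1)%N -> qnum q m \is a GRing.unit) ->
  q ^+ p \is a GRing.unit -> qnum q p ^+ N = 0 ->
  qHbar q star p.-1 k =
  (- (q ^+ p)^-1) ^+ wt k * (q ^+ p) ^+ d *
  \sum_(f : {ffun 'I_d -> 'I_N})
    ((q ^+ p)^-1 * qnum q p) ^+ wt (tuple_of_ffun f) *
    (index_bin k (tuple_of_ffun f))%:R *
    qH q star p.-1 [tuple of rev (index_add k (tuple_of_ffun f))].
Proof.
move=> p_gt0 k_gt0 mu Qu pN0; rewrite /qHbar.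
rewrite (reindex_inj (inv_inj reflect_tupleK)) /=.
have qrangeE (t : d.-tuple 'I_p.-1.+1) : qrange star (reflect_tuple t) = qrange star t.
  apply/idP/idP; last exact: qrange_reflect.
  by move/qrange_reflect; rewrite reflect_tupleK.
rewrite (eq_bigl _ _ qrangeE) [in RHS]/qH.
(* With the sum over [t] outermost on both sides, the identity can be proved for each [t]
   separately. *)
rewrite [X in _ = _ * X](eq_bigr _ (fun _ _ => mulr_sumr _ _ _ _)) exchange_big /=.
rewrite [RHS]mulr_sumr; apply: eq_bigr => t /andP[/all_tnthP t_gt0 _].
have mp a : (0 < tnth t a < p)%N by rewrite t_gt0 -[X in (_ < X)%N](prednK p_gt0) ltn_ord.
have factorE a (m := nat_of_ord (tnth t (rev_ord a))) :
    q ^+ tnth (reflect_tuple t) a / qnum q (tnth (reflect_tuple t) a) ^+ tnth k a =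
    (- (q ^+ p)^-1) ^+ tnth k a * q ^+ p *
    \sum_(l < N) ((q ^+ p)^-1 * qnum q p) ^+ l * 'C((tnth k a + l).-1, l)%:R *
      (q ^+ ((tnth k a + l).-1 * m) / qnum q m ^+ (tnth k a + l)).
  have /andP[m_gt0 m_ltp] := mp (rev_ord a).
  have -> : nat_of_ord (tnth (reflect_tuple t) a) = (p - m)%N.
    by rewrite tnth_reflect_tuple val_ordN //; congr (_ - _)%N; exact: prednK.
  apply: reflected_factor => //; first by rewrite m_gt0.
    by apply: mu; rewrite m_gt0 -ltnS prednK.
  by apply: mu; rewrite subn_gt0 m_ltp -ltnS prednK // ltn_subrL m_gt0.
rewrite (eq_bigr _ (fun a _ => factorE a)).
rewrite big_split big_split /=; congr (_ * _ * _).
- by rewrite prodrXr.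
- by rewrite prodr_const card_ord.
rewrite bigA_distr_bigA; apply: eq_bigr => f _.
rewrite !big_split /=; congr (_ * _ * _).
- rewrite prodrXr; congr (_ ^+ _); apply: eq_bigr => a _.
  by rewrite tnth_mktuple.
- by rewrite -natr_prod; congr (_%:R); apply: eq_bigr => a _; rewrite tnth_mktuple.
(* The factor at position [a] involves the entry of [t] at [rev_ord a], which is why the index on
   the right is reversed. *)
rewrite -!big_split [RHS](reindex_inj rev_ord_inj) /=; apply: eq_bigr => a _.
by rewrite tnth_rev_tuple rev_ordK !tnth_mktuple.
Qed.

(** * Divisibility by powers of [p] in the inverse limit *)

(** Named so that evaluation can be declared a ring morphism and products of families computed
    componentwise; [Qlevel] does the same for levels. *)
Definition prodring_eval {I : pointedType} {R : I -> comNzRingType} (i : I)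
  (f : prodring R) : R i := f i.

HB.instance Definition _ (I : pointedType) (R : I -> comNzRingType) (i : I) :=
  GRing.isZmodMorphism.Build (prodring R) (R i) (prodring_eval i)
    (fun f g => erefl).
HB.instance Definition _ (I : pointedType) (R : I -> comNzRingType) (i : I) :=
  GRing.isMonoidMorphism.Build (prodring R) (R i) (prodring_eval i)
    (conj erefl (fun f g => erefl)).

Definition Qlevel (n : nat) (x : Qhat) : Qring n := Qhat_val x n.
Arguments Qlevel : simpl never.

HB.instance Definition _ (n : nat) :=
  GRing.isZmodMorphism.Build Qhat (Qring n) (Qlevel n) (fun x y => erefl).
HB.instance Definition _ (n : nat) :=
  GRing.isMonoidMorphism.Build Qhat (Qring n) (Qlevel n)
    (conj erefl (fun x y => erefl)).

Lemma qnumX_monic (p : primenat) : (qnum 'X p : {poly Zloc p}) \is monic.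
Proof.
have -> : qnum 'X p = \poly_(i < p) 1 :> {poly Zloc p}.
  by rewrite /qnum poly_def; apply: eq_bigr => i _; rewrite scale1r.
by apply/monicP; rewrite lead_coef_poly ?oner_neq0 // prime_gt0 ?primenatP.
Qed.

Lemma Zquo_pi_qnum (p : primenat) (n : nat) : Zquo_pi n (qnum 'X p) = qnum (qZ p n) p.
Proof. by rewrite rmorph_qnum. Qed.

(** Representatives are chosen independently at each level, so they are compatible only up to the
    direct sum. *)
Lemma Qring_red_repr (x : Qhat) (n : nat) :
  finite_set [set p | Zquo_red (repr (Qhat_val x n.+1) p) != repr (Qhat_val x n) p].
Proof.
apply/Qring_piP; rewrite -Qring_redE /Qring_pi !reprK.
by have /asboolP := Qhat_valP x; apply.
Qed.

(* For all but finitely many p, depending on m, the representatives of x are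
   coherent up to level m; there, divisibility by [p]^(n+1) can be read off the
   polynomials, where [p] is monic and hence cancellable. *)
Lemma Qlevel_eq0 (x : Qhat) (n : nat) :
  Qlevel n x = 0 -> exists z, x = brp ^+ n.+1 * z.
Proof.
move=> xn0.
pose f m (p : primenat) : Zquo p m := repr (Qhat_val x m) p.
have fE m : Qring_pi (f m) = Qhat_val x m by rewrite /Qring_pi reprK.
have fn0 : finite_set [set p | f n p != 0].
  by apply/(Qring_piP (f n) 0); rewrite fE rmorph0.
pose bad m := [set p | f n p != 0] `|`
  \bigcup_(j in `I_m) [set p | Zquo_red (f j.+1 p) != f j p].
have bad_fin m : finite_set (bad m).
  by rewrite finite_setU; split=> //; apply: bigcup_finite => // j _;
    exact: Qring_red_repr.
have chain m p : ~ bad m p ->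
    forall j h, (j <= m)%N -> f m p = Zquo_pi m h -> f j p = Zquo_pi j h.
  move=> good j h; elim: m => [|m IH] in good *; first by rewrite leqn0 => /eqP ->.
  rewrite leq_eqVlt => /predU1P[-> //|]; rewrite ltnS => jm fm; apply: IH => //.
    by apply: contra_not good => -[?|[i /= im ?]]; [left|right; exists i => //=; exact: ltnW].
  apply/eqP; rewrite -(Zquo_redE m h) -fm eq_sym; apply/negPn/negP => ne.
  by apply: good; right; exists m => /=.
(* Level [n.+1 + m] is modulo [p]^(n+m+2), so division by [p]^(n+1) leaves a quotient determined
   modulo [p]^(m+1), as level [m] requires. At bad primes 0 is a placeholder. *)
have div m p : exists g, ~ bad (n.+1 + m)%N p ->
    f (n.+1 + m)%N p = Zquo_pi _ (g * qnum 'X p ^+ n.+1).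
  have [?|good] := pselect (bad (n.+1 + m)%N p); first by exists 0.
  have f_repr : f (n.+1 + m)%N p = Zquo_pi _ (repr (f (n.+1 + m)%N p)).
    by rewrite /Zquo_pi reprK.
  have := chain _ _ good n _ _ f_repr; rewrite addSn leqW ?leq_addr // => /(_ isT).
  have -> : f n p = 0 by apply/eqP/negPn/negP => ?; apply: good; left.
  rewrite -[0 in LHS](rmorph0 (@Zquo_pi p n)) => /esym/Zquo_piP[g].
  by rewrite subr0 => gE; exists g => _; rewrite -gE -f_repr.
have {div}[g gE] : exists g : forall (m : nat) (p : primenat), {poly Zloc p}, forall m p,
    ~ bad (n.+1 + m)%N p -> f (n.+1 + m)%N p = Zquo_pi _ (g m p * qnum 'X p ^+ n.+1).
  by exists (fun m p => sval (cid (div m p))) => m p; exact: (svalP (cid (div m p))).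
have zP : (fun m => Qring_pi (fun p => Zquo_pi m (g m p))) \in Qhat_pred.
  apply/asboolP => m; rewrite Qring_redE; apply/Qring_piP.
  apply: sub_finite_set (bad_fin (n.+1 + m.+1)%N) => p /= /eqP ne; apply: contrapT => good.
  apply: ne; rewrite Zquo_redE; apply/Zquo_piP.
  have good' : ~ bad (n.+1 + m)%N p.
    apply: contra_not good => -[?|[i /= im ?]]; [by left|right; exists i => //=].
    by rewrite addnS ltnW.
  (* The two multiples of [p]^(n+1) differ by a multiple of [p]^(n+m+2); cancelling [p]^(n+1) leaves
     [p]^(m+1). *)
  have := chain _ _ good (n.+1 + m)%N _ _ (gE _ _ good).
  rewrite gE // addnS leqnSn => /(_ isT)/esym/Zquo_piP[h].
  rewrite -mulrBl -addnS addnC exprD mulrA => /(rregX (monic_rreg (qnumX_monic p))) ->.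
  by exists h.
exists (MkQhat zP); apply: val_inj; apply: functional_extensionality_dep => m.
rewrite [RHS](rmorphM (Qlevel m)) rmorphXn /=.
rewrite -[Qlevel m brp]/(Qring_pi (fun p => qnum (qZ p m) p)) -rmorphXn.
rewrite -[LHS]fE -rmorphM; apply/Qring_piP.
apply: sub_finite_set (bad_fin (n.+1 + m)%N) => p /= /eqP ne; apply: contrapT => good.
apply: ne; rewrite (chain _ _ good m _ _ (gE _ _ good)) ?leq_addl //.
rewrite mulrC rmorphM rmorphXn /= Zquo_pi_qnum.
by rewrite -[RHS]/(prodring_eval p _) rmorphM rmorphXn.
Qed.

Lemma Qhat_ballP (x y : Qhat) (n : nat) :
  Qlevel n x = Qlevel n y -> Qhat_ball x n.+1 y.
Proof. by move=> xy; apply: Qlevel_eq0; rewrite rmorphB /= xy subrr. Qed.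

(** * Passage to the limit of the partial sums *)

Lemma index_bound (d N : nat) (l : d.-tuple nat) :
  (wt l < N)%N -> exists f : {ffun 'I_d -> 'I_N}, l = tuple_of_ffun f.
Proof.
case: N => // N lN; exists [ffun i => inord (tnth l i)].
apply: eq_from_tnth => i; rewrite tnth_mktuple ffunE inordK //.
by apply: leq_ltn_trans lN; rewrite /wt (bigD1 i) //= leq_addr.
Qed.

Lemma tuple_of_ffun_inj {d N : nat} : injective (@tuple_of_ffun d N).
Proof.
move=> f g fg; apply/ffunP => i; apply: val_inj.
by have := congr1 (fun l => tnth l i) fg; rewrite !tnth_mktuple.
Qed.

Definition zeta_term (star : bool) {d : nat} (k l : d.-tuple nat) : Qhat :=
  (qpinv * brp) ^+ wt l * (index_bin k l)%:R
  * zetaQ star [tuple of rev (index_add k l)].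

Lemma Qlevel_zetabarQ (star : bool) {d : nat} (k : d.-tuple nat) (n : nat) :
  (forall i, 0 < tnth k i)%N ->
  Qlevel n (zetabarQ star k) =
  Qlevel n ((- qpinv) ^+ wt k * qp ^+ d *
    \sum_(f : {ffun 'I_d -> 'I_n.+1}) zeta_term star k (tuple_of_ffun f)).
Proof.
move=> k_gt0.
pose Q : prodring (fun p => Zquo p n) := fun p => qZ p n ^+ p.
pose Qi : prodring (fun p => Zquo p n) := fun p => (qZ p n ^+ p)^-1.
pose P : prodring (fun p => Zquo p n) := fun p => qnum (qZ p n) p.
pose Z l : prodring (fun p => Zquo p n) := fun p =>
  qH (qZ p n) star p.-1 [tuple of rev (index_add k l)].
(* The finite expansion holds at every prime, so it is applied in the product ring, before the
   quotient by the direct sum, with [N = n.+1] since [p]^(n+1) = 0 there. *)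
transitivity (Qring_pi ((- Qi) ^+ wt k * Q ^+ d *
  \sum_(f : {ffun 'I_d -> 'I_n.+1})
    ((Qi * P) ^+ wt (tuple_of_ffun f) * (index_bin k (tuple_of_ffun f))%:R
     * Z (tuple_of_ffun f)))).
  congr Qring_pi; apply: functional_extensionality_dep => p.
  rewrite -[RHS]/(prodring_eval p _) 2!rmorphM !rmorphXn rmorphN rmorph_sum /=.
  under eq_bigr do rewrite 2!rmorphM rmorphXn rmorphM rmorph_nat /=.
  apply: qHbar_expansion => //; rewrite ?prime_gt0 ?primenatP //.
  - exact: qnumZ_unit.
  - exact: qpZ_unit.
  - exact: qnumZ_nilp.
rewrite [LHS]rmorphM rmorphM !rmorphXn rmorphN rmorph_sum /=.
rewrite [RHS]rmorphM rmorphM !rmorphXn rmorphN rmorph_sum /=.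
congr (_ * _); apply: eq_bigr => f _.
by rewrite 2!rmorphM rmorphXn rmorphM rmorph_nat /=
  [RHS]rmorphM rmorphM rmorphXn rmorphM rmorph_nat.
Qed.

(** The box itself is the threshold: an index outside it has weight at least n + 1, so its term
    carries a power of [p] that vanishes at level [n]. *)
Lemma Qlevel_partial_sum (star : bool) {d : nat} (k : d.-tuple nat) (n : nat) :
  \forall A \near totally, Qlevel n (partial_sum (zeta_term star k) A) =
    Qlevel n (\sum_(f : {ffun 'I_d -> 'I_n.+1}) zeta_term star k (tuple_of_ffun f)).
Proof.
exists [fset tuple_of_ffun f | f in {: {ffun 'I_d -> 'I_n.+1}}]%fset => // A /= box_sub.
rewrite /partial_sum -(big_seq_fsetE _ _ predT) !rmorph_sum /=.
rewrite -(big_fset_incl _ box_sub); last first.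
  move=> l _ l_out; rewrite 2!rmorphM exprMn rmorphM /=.
  rewrite [Qlevel n (brp ^+ _)]brp_exp_val ?mulr0 ?mul0r // ltnNge.
  apply: contra l_out; rewrite -ltnS => /index_bound[f ->].
  by apply/imfsetP; exists f.
rewrite big_imfset /= => [|f g _ _]; last exact: tuple_of_ffun_inj.
apply: perm_big; apply: uniq_perm; rewrite ?enum_finmem_uniq ?enum_uniq ?index_enum_uniq // => f.
by rewrite mem_index_enum mem_enum.
Qed.

Theorem theorem5p1 (star : bool) (d : nat) (k : d.-tuple nat)
    (k_gt0 : forall i : 'I_d, (0 < tnth k i)%N) :
  let term (l : d.-tuple nat) : Qhat :=
    (qpinv * brp) ^+ wt l * (index_bin k l)%:R
    * zetaQ star [tuple of rev (index_add k l)] in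
  cvg (partial_sum term @ totally) /\
  zetabarQ star k =
    (- qpinv) ^+ wt k * qp ^+ d * lim (partial_sum term @ totally).
Proof.
have totallyF : ProperFilter (@totally (d.-tuple nat)) := totally_filter.
move=> term; pose c := (- qpinv) ^+ wt k * qp ^+ d.
(* The inverse of the prefactor [c] identifies the limit directly, without appeal to continuity of
   multiplication. *)
pose c' := (- qp) ^+ wt k * qpinv ^+ d.
have cc' : c * c' = 1.
  by rewrite mulrACA -!exprMn mulrNN [qp * _]mulrC qpinvK !expr1n mulr1.
have term_cvg : partial_sum term @ totally --> c' * zetabarQ star k.
  move=> U [n _ ballU].
  apply: filterS (Qlevel_partial_sum star k n) => A AE.
  apply: ballU.
  (* Agreement at level [n] is agreement modulo [p]^(n+1), one power more than the ball requires. *)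
  suff [z zE] : Qhat_ball (c' * zetabarQ star k) n.+1 (partial_sum term A).
    by exists (brp * z); rewrite zE exprSr mulrA.
  apply: Qhat_ballP; rewrite AE rmorphM /= Qlevel_zetabarQ // -rmorphM /=.
  by rewrite -/c mulrA [c' * c]mulrC cc' mul1r.
split; first by apply/cvg_ex; exists (c' * zetabarQ star k).
by rewrite (cvg_lim Qhat_hausdorff term_cvg) mulrA -/c cc' mul1r.
Qed.
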